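(* Let $X, Y$ be complete (possibly infinite) metric spaces and let $\epsilon \ge 0$ be real. For each $\epsilon$-ml-isomorphism $\kappa : \mathrm{Lip}\,Y \to \mathrm{Lip}\,X$ there is an $88\epsilon$-isometry $\eta : X \to Y$ such that $\kappa$ is $62\epsilon$-near $f \mapsto f\circ\eta$, i.e. $\sup_{x\in X} |(\kappa f)(x) - f(\eta(x))| \le 62\epsilon$ for all $f \in \mathrm{Lip}\,Y$.
   Context: Let $Z = \mathbb{R}_{\ge 0}\cup\{\infty\}$ with $\infty + z = z+\infty = \infty$ and $z \le \infty$ for all $z\in Z$. A (possibly infinite) metric space is a non-empty set $X$ with a symmetric map $d : X\times X \to Z$ that is positive-definite ($d(x,y)=0$ iff $x=y$) and satisfies the triangle inequality. Its components are the equivalence classes of the relation $d(x,x')\neq\infty$; $X$ is complete iff every component is complete as an ordinary metric space. For $a,b,z \in Z$, $|a-b|\le z$ means $a \le b+z$ and $b \le a+z$; thus $|\infty-\infty| = 0$ and $|\infty - a| = \infty$ for finite $a$, and $|a-b|$ is a (possibly infinite) metric on $Z$. All metrics are denoted $d$. $\mathrm{Lip}\,X$ is the set of all $f: X\to Z$ with $|f(x)-f(y)| \le d(x,y)$ for all $x,y\in X$. It carries the (possibly infinite) metric $d_\infty(f,g) = \sup_{x\in X}|f(x)-g(x)|$ and the pointwise supremum $\bigvee$ and infimum $\bigwedge$ of arbitrary families (these stay in $\mathrm{Lip}\,X$), with $\bigvee_\emptyset = 0$ and $\bigwedge_\emptyset = \infty$ (constant functions). For real $\epsilon\ge 0$ and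 (possibly infinite) metric spaces $A,B$: two maps $\alpha,\beta:A\to B$ are $\epsilon$-near if $d(\alpha a,\beta a)\le\epsilon$ for all $a\in A$. A (not necessarily continuous) map $\eta : A\to B$ is an $\epsilon$-isometric embedding if $|d(a,a') - d(\eta a,\eta a')|\le \epsilon$ for all $a,a'\in A$. An $\epsilon$-isometry is a pair of $\epsilon$-isometric embeddings $\eta:A\to B$, $\eta':B\to A$ such that $\eta\circ\eta'$ and $\eta'\circ\eta$ are $\epsilon$-near the respective identities; when one speaks of an $\epsilon$-isometry $\eta:A\to B$, a corresponding $\eta'$ is implied. An $\epsilon$-ml-homomorphism is an $\epsilon$-isometric embedding $\kappa:\mathrm{Lip}\,Y\to\mathrm{Lip}\,X$ (for the metrics $d_\infty$) such that $d_\infty(\bigvee_{j\in J}\kappa f_j, \kappa\bigvee_{j\in J} f_j)\le\epsilon$ and $d_\infty(\bigwedge_{j\in J}\kappa f_j, \kappa\bigwedge_{j\in J} f_j)\le\epsilon$ for every family $(f_j)_{j\in J}$ in $\mathrm{Lip}\,Y$ over any index set $J$ (including $J=\emptyset$). An $\epsilon$-ml-isomorphism is a pair of $\epsilon$-ml-homomorphisms $\kappa:\mathrm{Lip}\,Y\to\mathrm{Lip}\,X$, $\kappa':\mathrm{Lip}\,X\to\mathrm{Lip}\,Y$ such that $\kappa\circ\kappa'$ and $\kappa'\circ\kappa$ are $\epsilon$-near the respective identities; when one speaks of an $\epsilon$-ml-isomorphism $\kappa$, a corresponding $\kappa'$ is implied. *)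

(* Defs.v *)
(* Distances and function values are elements of [\bar R] that are required to
   be nonnegative: the nonnegative part of [\bar R] is Z = [0, +oo]. *)
From HB Require Import structures.
From mathcomp Require Import all_boot all_order all_algebra.
From mathcomp Require Import all_classical all_reals all_analysis.

Set Implicit Arguments.
Unset Strict Implicit.
Unset Printing Implicit Defensive.

Import Order.TTheory GRing.Theory Num.Theory.

Local Open Scope classical_set_scope.
Local Open Scope ring_scope.
Local Open Scope ereal_scope.

(* The distance |a - b| on [0, +oo].  The case distinction is needed because
   [+oo - +oo = -oo] in [\bar R], so that [`|+oo - +oo|] would be [+oo]. *)
Definition zdist (R : realType) (a b : \bar R) : \bar R :=
  if a == b then 0 else `|a - b|.

Section zdist_theory.
Context {R : realType}.
Implicit Types a b c z : \bar R.

Lemma zdist_ge0 a b : 0 <= zdist a b.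
Proof. by rewrite /zdist; case: ifP => // _; exact: abse_ge0. Qed.

Lemma zdist_leP a b z : 0 <= a -> 0 <= b -> 0 <= z ->
  zdist a b <= z <-> a <= b + z /\ b <= a + z.
Proof.
rewrite /zdist => a0 b0 z0; case: eqP => [<-|ab].
  by split => // _; split; rewrite leeDl.
move: a b z a0 b0 z0 ab => [a| |] [b| |] [z| |] //=;
  rewrite ?leey ?lee_fin => a0 b0 z0 ab.
all: try by split.
all: try by split=> // -[? ?].
by rewrite ler_distl lerBlDr; split=> [/andP[]|[? ?]]; [split|apply/andP; split].
Qed.

Lemma zdistC a b : 0 <= a -> 0 <= b -> zdist a b = zdist b a.
Proof.
by move=> a0 b0; apply/eqP; rewrite eq_le; apply/andP; split;
  apply/(zdist_leP _ _ (zdist_ge0 _ _)) => //;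
  apply/and_comm; apply/(zdist_leP _ _ (zdist_ge0 _ _)).
Qed.

Lemma zdistxx a : zdist a a = 0.
Proof. by rewrite /zdist eqxx. Qed.

Lemma zdist_eq0 a b : 0 <= a -> 0 <= b -> zdist a b = 0 -> a = b.
Proof.
move=> a0 b0 ab; have : zdist a b <= 0 by rewrite ab.
move/(zdist_leP a0 b0 (lexx _)); rewrite !adde0 => -[? ?].
by apply/eqP; rewrite eq_le; apply/andP; split.
Qed.

Lemma zdist_triangle b a c : 0 <= a -> 0 <= b -> 0 <= c ->
  zdist a c <= zdist a b + zdist b c.
Proof.
move=> a0 b0 c0.
have [ab ba] := (zdist_leP a0 b0 (zdist_ge0 _ _)).1 (lexx (zdist a b)).
have [bc cb] := (zdist_leP b0 c0 (zdist_ge0 _ _)).1 (lexx (zdist b c)).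
apply/zdist_leP => //; first by rewrite adde_ge0// zdist_ge0.
split.
  by rewrite (le_trans ab)// (addeC (zdist a b)) addeA leeD2r.
by rewrite (le_trans cb)// addeA leeD2r.
Qed.

End zdist_theory.

Record extMetric (R : realType) := ExtMetric {
  em_sort :> Type;
  dist : em_sort -> em_sort -> \bar R;
  em_inhabited : inhabited em_sort;
  dist_ge0 : forall x y, 0 <= dist x y;
  dist_sym : forall x y, dist x y = dist y x;
  dist_eq0 : forall x y, dist x y = 0 <-> x = y;
  dist_triangle : forall y x z, dist x z <= dist x y + dist y z }.

Definition component (R : realType) (X : extMetric R) (x0 : X) : Type :=
  {x : X | dist x0 x != +oo}.

Section component_metric.
Context {R : realType} {X : extMetric R} {x0 : X}.
Implicit Types x y z : component x0.

Definition component_dist x y : R := fine (dist (sval x) (sval y)).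

Lemma component_dist_fin x y : dist (sval x) (sval y) \is a fin_num.
Proof.
rewrite ge0_fin_numE ?dist_ge0//.
rewrite (le_lt_trans (dist_triangle x0 _ _))// lte_add_pinfty// ltey.
  by rewrite dist_sym (svalP x).
exact: svalP y.
Qed.

Lemma component_distxx x : component_dist x x = 0%R.
Proof. by rewrite /component_dist (dist_eq0 _ _).2. Qed.

Lemma component_dist_positivity x y : component_dist x y = 0%R -> x = y.
Proof.
move=> xy0; apply: eq_sig_hprop => [z|]; first exact: Prop_irrelevance.
apply/dist_eq0; rewrite -(fineK (component_dist_fin x y)).
by rewrite -/(component_dist x y) xy0.
Qed.

Lemma component_dist_sym x y : component_dist x y = component_dist y x.
Proof. by rewrite /component_dist dist_sym. Qed.

Lemma component_dist_triangle y x z :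
  (component_dist x z <= component_dist x y + component_dist y z)%R.
Proof.
by rewrite -lee_fin EFinD !fineK ?component_dist_fin//; exact: dist_triangle.
Qed.

HB.instance Definition _ := gen_eqMixin (component x0).
HB.instance Definition _ := gen_choiceMixin (component x0).
HB.instance Definition _ := @isMetric.Build R (component x0) component_dist
  component_distxx component_dist_positivity component_dist_sym
  component_dist_triangle.

End component_metric.

(* Completeness of the [metricType] [component x0] is stated with Cauchy
   filters as in [completeType], but [exists x, F --> x] replaces [cvg F],
   which needs a pointed type. *)
Definition em_complete (R : realType) (X : extMetric R) : Prop :=
  forall (x0 : X) (F : set_system (component x0)),
    ProperFilter F -> cauchy F -> exists x : component x0, F --> x.

(* The sup-distance, for arbitrary functions with values in [0, +oo]. *)
Definition dsup (R : realType) (T : Type) (f g : T -> \bar R) : \bar R :=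
  ereal_sup (range (fun x => zdist (f x) (g x))).

Record lip (R : realType) (X : extMetric R) := Lip {
  lip_fun :> X -> \bar R;
  lip_ge0 : forall x, 0 <= lip_fun x;
  lip_dist : forall x y, zdist (lip_fun x) (lip_fun y) <= dist x y }.

Section lip_metric.
Context {R : realType} {X : extMetric R}.
Implicit Types f g h : lip X.

Lemma lip_ext f g : (forall x, f x = g x) -> f = g.
Proof.
case: f g => [f f0 fl] [g g0 gl] /= /funext fg; subst g.
by congr Lip; exact: Prop_irrelevance.
Qed.

Lemma lip_leD f x y : f x <= f y + dist x y.
Proof.
by have [] := (zdist_leP (lip_ge0 f x) (lip_ge0 f y) (dist_ge0 x y)).1
  (lip_dist f x y).
Qed.

Lemma dsup_ub f g x : zdist (f x) (g x) <= dsup f g.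
Proof. by apply: ereal_sup_ubound; exists x. Qed.

Lemma lip_inhabited : inhabited (lip X).
Proof.
constructor; apply: (@Lip R X (fun=> 0)) => // x y.
by rewrite zdistxx dist_ge0.
Qed.

Lemma dsup_ge0 f g : 0 <= dsup f g.
Proof.
by have [x] := em_inhabited X; rewrite (le_trans _ (dsup_ub f g x))// zdist_ge0.
Qed.

Lemma dsup_sym f g : dsup f g = dsup g f.
Proof.
rewrite /dsup; congr ereal_sup; apply: eq_imagel => x _.
by rewrite zdistC ?lip_ge0.
Qed.

Lemma dsup_eq0 f g : dsup f g = 0 <-> f = g.
Proof.
split=> [fg0|<-].
  apply: lip_ext => x; apply: zdist_eq0; rewrite ?lip_ge0//.
  by apply/eqP; rewrite eq_le zdist_ge0 andbT -fg0 dsup_ub.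
apply/eqP; rewrite eq_le dsup_ge0 andbT; apply: ge_ereal_sup => _ [x _ <-].
by rewrite zdistxx.
Qed.

Lemma dsup_triangle g f h : dsup f h <= dsup f g + dsup g h.
Proof.
apply: ge_ereal_sup => _ [x _ <-].
rewrite (le_trans (zdist_triangle (lip_ge0 f x) (lip_ge0 g x) (lip_ge0 h x)))//.
by apply: leeD; exact: dsup_ub.
Qed.

Canonical lip_extMetric : extMetric R := @ExtMetric R (lip X)
  (fun f g => dsup f g) lip_inhabited dsup_ge0 dsup_sym dsup_eq0 dsup_triangle.

Section families.
Variables (J : Type) (f : J -> lip X).

(* The [maxe 0] matters only for empty [J], where [ereal_sup] is [-oo]
   whereas the supremum in [0, +oo] is [0]. *)
Definition lip_sup_fun x : \bar R := maxe 0 (ereal_sup (range (fun j => f j x))).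
Definition lip_inf_fun x : \bar R := ereal_inf (range (fun j => f j x)).

Lemma lip_sup_ge0 x : 0 <= lip_sup_fun x.
Proof. by rewrite le_max lexx. Qed.

Lemma lip_inf_ge0 x : 0 <= lip_inf_fun x.
Proof. by apply: le_ereal_inf_tmp => _ [j _ <-]; exact: lip_ge0. Qed.

Lemma lip_sup_leD x y : lip_sup_fun x <= lip_sup_fun y + dist x y.
Proof.
rewrite {1}/lip_sup_fun ge_max adde_ge0 ?lip_sup_ge0 ?dist_ge0//=.
apply: ge_ereal_sup => _ [j _ <-].
rewrite (le_trans (lip_leD (f j) x y))// leeD2r// le_max; apply/orP; right.
by apply: ereal_sup_ubound; exists j.
Qed.

Lemma lip_inf_leD x y : lip_inf_fun x <= lip_inf_fun y + dist x y.
Proof.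
have [->|dxy] := eqVneq (dist x y) +oo.
  by rewrite addey ?leey// gt_eqF// (lt_le_trans _ (lip_inf_ge0 y)).
have dfin : dist x y \is a fin_num by rewrite ge0_fin_numE ?dist_ge0// ltey.
rewrite -leeBlDr//; apply: le_ereal_inf_tmp => _ [j _ <-]; rewrite leeBlDr//.
rewrite (le_trans _ (lip_leD (f j) x y))//.
by apply: ereal_inf_lbound; exists j.
Qed.

Lemma lip_sup_dist x y : zdist (lip_sup_fun x) (lip_sup_fun y) <= dist x y.
Proof.
apply/zdist_leP; rewrite ?lip_sup_ge0 ?dist_ge0//.
split; first exact: lip_sup_leD.
by rewrite dist_sym lip_sup_leD.
Qed.

Lemma lip_inf_dist x y : zdist (lip_inf_fun x) (lip_inf_fun y) <= dist x y.
Proof.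
apply/zdist_leP; rewrite ?lip_inf_ge0 ?dist_ge0//.
split; first exact: lip_inf_leD.
by rewrite dist_sym lip_inf_leD.
Qed.

Definition lip_sup : lip X := Lip lip_sup_ge0 lip_sup_dist.
Definition lip_inf : lip X := Lip lip_inf_ge0 lip_inf_dist.

End families.
End lip_metric.

Section approximate_maps.
Context {R : realType}.
Implicit Types (eps : R) (A B : extMetric R).

Definition eps_near eps A B (alpha beta : A -> B) : Prop :=
  forall a, dist (alpha a) (beta a) <= eps%:E.

Definition isometric_embedding eps A B (eta : A -> B) : Prop :=
  forall a a', zdist (dist a a') (dist (eta a) (eta a')) <= eps%:E.

Definition isometry_pair eps A B (eta : A -> B) (eta' : B -> A) : Prop :=
  [/\ isometric_embedding eps eta, isometric_embedding eps eta',
      eps_near eps (eta \o eta') idfun & eps_near eps (eta' \o eta) idfun].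

Definition ml_homomorphism eps A B (kappa : lip A -> lip B) : Prop :=
  [/\ isometric_embedding eps kappa,
      forall (J : Type) (f : J -> lip A),
        dist (lip_sup (kappa \o f)) (kappa (lip_sup f)) <= eps%:E &
      forall (J : Type) (f : J -> lip A),
        dist (lip_inf (kappa \o f)) (kappa (lip_inf f)) <= eps%:E].

Definition ml_isomorphism_pair eps A B
    (kappa : lip A -> lip B) (kappa' : lip B -> lip A) : Prop :=
  [/\ ml_homomorphism eps kappa, ml_homomorphism eps kappa',
      eps_near eps (kappa \o kappa') idfun &
      eps_near eps (kappa' \o kappa) idfun].

End approximate_maps.

(* Main.v *)
Require Import Defs.
From mathcomp Require Import all_boot all_order all_algebra.
From mathcomp Require Import all_classical all_reals all_analysis.
From mathcomp Require Import lra.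

Set Implicit Arguments.
Unset Strict Implicit.
Unset Printing Implicit Defensive.

Import Order.TTheory GRing.Theory Num.Theory.

Local Open Scope classical_set_scope.
Local Open Scope ring_scope.
Local Open Scope ereal_scope.

(** A point [x] is visible in [lip X] as the function [dist x], the vertex of
    [x]: the sup-distance between two vertices is the distance of the points
    ([dsup_vertex]).  The theorem holds because [kappa'] sends every vertex to
    within a multiple of [eps] of a vertex; [eta x] is the point of the latter.

    This uses the cones [c + dist x].  Every [f : lip X] is the infimum of the
    cones [f x + dist x] ([lip_inf_cones]), and a cone with finite [c] is prime
    for infima: a family whose infimum is at most [c] at [x] has a member that
    is at most [c + delta] at [x], hence everywhere below the cone plus
    [delta].  Write [q], the image of the cone at [x] under [kappa'], as an
    infimum of cones.  Applying [kappa], which almost preserves infima and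
    order, puts the image of one of these cones almost below the cone at [x];
    going back with [kappa'] shows that [q] is itself almost a cone
    ([iso_cone]).  Its height is almost [c], because constants are almost
    preserved ([iso_cst]) and [c] is the largest constant below the cone.

    For [eps > 0] the slack [delta] is absorbed by [eps].  For [eps = 0] the
    image of a vertex is a limit of vertices, hence a vertex by completeness
    ([iso_vertex]).  The images of the cones at [x] of all finite heights are
    almost cones at the same point [eta x], since the height of a cone over a
    vertex controls the distance of their apices
    ([iso_cone_at_vertex_image]).

    Everything else is order theory.  Since [f <= c + dist x] amounts to
    [f x <= c], a value of a function is determined by the cones above the
    function; hence [kappa f x] is almost [f (eta x)] ([eval_vertex_image]).
    Likewise [dist x x'] is the least [a] with [dist x <= dist x' + a], so
    [eta] almost preserves distances.  Exchanging [kappa] and [kappa'] yields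
    [eta'], and that [kappa] and [kappa'] are almost inverse yields the same
    for [eta] and [eta'].

    All estimates are one-sided inequalities up to an additive real constant;
    the two maps are used only through their almost monotonicity
    ([hom_mono]), near-invertibility and behaviour on infima and on [0]. *)

(** * Inequalities up to an additive constant *)

Definition approx_le (R : realType) (T : Type) (a : R) (f g : T -> \bar R) :=
  forall x, f x <= g x + a%:E.

Notation "f <=[ a ] g" := (approx_le a f g)
  (at level 70, a at level 0, g at next level, format "f  <=[ a ]  g").

Section approx_order.
Context {R : realType}.

Lemma approx_le_trans (T : Type) (g f h : T -> \bar R) (a b : R) :
  f <=[a] g -> g <=[b] h -> f <=[(a + b)%R] h.
Proof.
move=> fg gh x; rewrite (le_trans (fg x))// (addrC a) EFinD addeA.
by rewrite leeD2r.
Qed.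

Lemma approx_leW (T : Type) (f g : T -> \bar R) (a b : R) :
  (a <= b)%R -> f <=[a] g -> f <=[b] g.
Proof. by move=> ab fg x; rewrite (le_trans (fg x))// leeD2l// lee_fin. Qed.

Lemma le_approx_le (T : Type) (f g : T -> \bar R) :
  (forall x, f x <= g x) -> f <=[0%R] g.
Proof. by move=> fg x; rewrite adde0. Qed.

Lemma dsup_leP (T : Type) (f g : T -> \bar R) (a : R) :
    (forall x, 0 <= f x) -> (forall x, 0 <= g x) -> (0 <= a)%R ->
  dsup f g <= a%:E <-> f <=[a] g /\ g <=[a] f.
Proof.
move=> f0 g0 a0; split=> [fga|[fg gf]].
  have fgx x : f x <= g x + a%:E /\ g x <= f x + a%:E.
    apply/zdist_leP; rewrite ?lee_fin//; apply: le_trans fga.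
    by apply: ereal_sup_ubound; exists x.
  by split=> x; have [] := fgx x.
apply: ge_ereal_sup => _ [x _ <-].
by apply/zdist_leP; rewrite ?lee_fin.
Qed.

Lemma lip_dsup_leP (X : extMetric R) (f g : lip X) (a : R) : (0 <= a)%R ->
  dsup f g <= a%:E <-> f <=[a] g /\ g <=[a] f.
Proof. by apply: dsup_leP; exact: lip_ge0. Qed.

End approx_order.

(** * Cones and vertices *)

Section cones.
Context {R : realType} {X : extMetric R}.

Lemma cst_lip_dist (c : \bar R) (x y : X) : zdist c c <= dist x y.
Proof. by rewrite zdistxx dist_ge0. Qed.

Definition cst_lip (c : \bar R) (c0 : 0 <= c) : lip X :=
  @Lip R X (fun=> c) (fun=> c0) (cst_lip_dist c).

Lemma cone_ge0 (x : X) (c : \bar R) (c0 : 0 <= c) y : 0 <= c + dist x y.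
Proof. by rewrite adde_ge0 ?dist_ge0. Qed.

Lemma cone_dist (x : X) (c : \bar R) (c0 : 0 <= c) y z :
  zdist (c + dist x y) (c + dist x z) <= dist y z.
Proof.
apply/zdist_leP; rewrite ?cone_ge0 ?dist_ge0//; split; rewrite -addeA leeD2l//.
  by rewrite (dist_sym y z) dist_triangle.
exact: dist_triangle.
Qed.

Definition cone (x : X) (c : \bar R) (c0 : 0 <= c) : lip X :=
  Lip (cone_ge0 x c0) (cone_dist x c0).

Definition vertex (x : X) : lip X := cone x (lexx 0).

Lemma cone_apex (x : X) (c : \bar R) (c0 : 0 <= c) : cone x c0 x = c.
Proof. by rewrite /= (dist_eq0 _ _).2 ?adde0. Qed.

(** By the Lipschitz condition, being below a cone is a condition at its apex
    only.  This makes cones prime for infima. *)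
Lemma approx_le_cone (f : lip X) (x : X) (c : \bar R) (c0 : 0 <= c) (a : R) :
  f x <= c + a%:E -> f <=[a] cone x c0.
Proof.
move=> fx y; rewrite (le_trans (lip_leD f y x))// (dist_sym y x) /=.
by rewrite (addeAC c) leeD2r.
Qed.

Lemma cone_mono (x : X) (c c' : \bar R) (c0 : 0 <= c) (c'0 : 0 <= c')
  (a : R) : c <= c' + a%:E -> cone x c0 <=[a] cone x c'0.
Proof. by move=> cc'; apply: approx_le_cone; rewrite cone_apex. Qed.

Lemma vertex_approx_leP (x y : X) (a : R) :
  vertex x <=[a] vertex y <-> dist x y <= a%:E.
Proof.
split=> [/(_ y)|xy]; last first.
  by apply: approx_le_cone; rewrite /= !add0e.
by rewrite cone_apex /= !add0e.
Qed.

(** The Kuratowski embedding, which needs no base point because infinite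
    values are allowed. *)
Lemma dsup_vertex (x y : X) : dsup (vertex x) (vertex y) = dist x y.
Proof.
apply/eqP; rewrite eq_le; apply/andP; split; last first.
  have := dsup_ub (vertex x) (vertex y) y; apply: le_trans.
  rewrite cone_apex /= add0e /zdist; case: eqP => [->//|_].
  by rewrite sube0 gee0_abs ?dist_ge0.
apply: ge_ereal_sup => _ [z _ <-] /=; rewrite !add0e (dist_sym x) (dist_sym y).
apply/zdist_leP; rewrite ?dist_ge0//; split.
  by rewrite (dist_sym x y) dist_triangle.
exact: dist_triangle.
Qed.

Lemma lip_inf_cones (f : lip X) :
  lip_inf (fun x => cone x (lip_ge0 f x)) = f.
Proof.
apply: lip_ext => x; apply/eqP; rewrite eq_le; apply/andP; split.
  apply: ereal_inf_lbound; exists x => //; exact: cone_apex.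
apply: le_ereal_inf_tmp => _ [y _ <-] /=.
by rewrite dist_sym lip_leD.
Qed.

(** The Kuratowski image of a complete space is closed.  The points whose
    vertex is [a]-near [h] form, for [a > 0], the base of a Cauchy filter; they
    are at finite distance from each other, so the filter lives in one
    component. *)
Lemma vertex_closed (cX : em_complete X) (h : lip X) :
    (forall delta : R, (0 < delta)%R ->
      exists x, dsup h (vertex x) <= delta%:E) ->
  exists x, h = vertex x.
Proof.
move=> hX.
have dist_le (x y : X) (a b : R) : dsup h (vertex x) <= a%:E ->
    dsup h (vertex y) <= b%:E -> dist x y <= (a + b)%:E.
  move=> hx hy; rewrite -dsup_vertex EFinD.
  by rewrite (le_trans (dsup_triangle h _ _))// leeD// dsup_sym.
have [x0 hx0] := hX _ ltr01.
pose B (a : R) : set (component x0) :=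
  [set z | dsup h (vertex (sval z)) <= a%:E].
pose F : set_system (component x0) :=
  fun S => exists2 a : R, (0 < a)%R & B a `<=` S.
have FB (a : R) : (0 < a)%R -> F (B a) by move=> a0; exists a.
have B0 (a : R) : (0 < a)%R -> B a !=set0.
  move=> a0; have [x hx] := hX _ a0.
  have x0x : dist x0 x != +oo.
    by rewrite -ltey (le_lt_trans (dist_le _ _ _ _ hx0 hx))// ltry.
  by exists (exist _ x x0x).
have FF : ProperFilter F.
  split; first by case=> a a0 Ba; have [z /Ba] := B0 _ a0.
  split; first by exists 1%R.
    move=> P Q [a a0 aP] [b b0 bQ]; exists (Num.min a b).
      by rewrite lt_min a0.
    move=> z; rewrite /B /= EFin_min le_min => /andP[za zb].
    by split; [exact: aP|exact: bQ].
  by move=> P Q PQ [a a0 aP]; exists a => //; exact: subset_trans PQ.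
have ball_dist (y z : component x0) (a : R) :
    ball y a z <-> dist (sval y) (sval z) < a%:E.
  rewrite ballEmdist /= -lte_fin.
  by rewrite -(fineK (component_dist_fin y z)).
have Fcauchy : cauchy F.
  apply/cauchy_ballP => a a0.
  exists (B (a / 3)%R, B (a / 3)%R).
    by split; apply: FB; lra.
  case=> y z [/= hy hz]; apply/ball_dist.
  by rewrite (le_lt_trans (dist_le _ _ _ _ hy hz))// lte_fin; lra.
have [x Fx] := cX x0 F FF Fcauchy.
exists (sval x); apply/dsup_eq0/eqP.
rewrite eq_le dsup_ge0 andbT; apply/lee_addgt0Pr => a a0; rewrite add0e.
have a20 : (0 < a / 2)%R by lra.
have [b b0 Bb] := Fx _ (nbhsx_ballx x _ a20).
have [z] : B (Num.min b (a / 2)%R) !=set0 by apply: B0; rewrite lt_min b0.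
rewrite /B /mkset EFin_min le_min => /andP[/Bb/ball_dist/ltW xz hz].
rewrite (le_trans (dsup_triangle (vertex (sval z)) _ _))//.
rewrite (splitr a) EFinD leeD// dsup_vertex dist_sym//.
Qed.

End cones.

(** * Almost homomorphisms *)

Section homomorphism.
Context {R : realType} {A B : extMetric R} {eps : R} {k : lip A -> lip B}.
Hypothesis kP : ml_homomorphism eps k.

Lemma hom_eps_ge0 : (0 <= eps)%R.
Proof.
have [kiso _ _] := kP; have [f] := lip_inhabited (X := A).
by rewrite -lee_fin (le_trans _ (kiso f f))// zdist_ge0.
Qed.

Lemma hom_inf (J : Type) (f : J -> lip A) :
  lip_inf (k \o f) <=[eps] k (lip_inf f) /\
  k (lip_inf f) <=[eps] lip_inf (k \o f).
Proof.
have eps0 := hom_eps_ge0.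
by case: kP => _ _ kinf; apply/lip_dsup_leP => //; exact: kinf.
Qed.

(** [0] is the supremum of the empty family. *)
Lemma hom_zero : k (cst_lip (lexx 0)) <=[eps] cst_lip (lexx 0).
Proof.
have eps0 := hom_eps_ge0.
have sup0 (C : extMetric R) (f : void -> lip C) :
    lip_sup f = cst_lip (lexx 0).
  apply: lip_ext => x; rewrite /= /lip_sup_fun.
  have -> : range (fun j => f j x) = set0 by rewrite -subset0 => _ [[]].
  by rewrite ereal_sup0 maxeNy.
case: kP => _ ksup _.
have /lip_dsup_leP := ksup void (fun j => match j with end).
by rewrite !sup0 => /(_ eps0)[].
Qed.

(** If [f <= g + a] then [f] is [a]-near the infimum of [f] and [g]; [eps] is
    lost once to the isometry condition and once to the infimum. *)
Lemma hom_mono (f g : lip A) (a : R) : (0 <= a)%R ->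
  f <=[a] g -> k f <=[(a + 2 * eps)%R] k g.
Proof.
have eps0 := hom_eps_ge0.
move=> a0 fg; pose fog (b : bool) := if b then f else g.
have fh : dsup f (lip_inf fog) <= a%:E.
  apply/lip_dsup_leP => //; split=> x.
    rewrite -leeBlDr//; apply: le_ereal_inf_tmp => _ [[] _ <-].
      by rewrite leeBlDr// leeDl// lee_fin.
    by rewrite leeBlDr//; exact: fg.
  rewrite (@le_trans _ _ (f x))// ?leeDl ?lee_fin//.
  by apply: ereal_inf_lbound; exists true.
have kfh : k f <=[(a + eps)%R] k (lip_inf fog).
  have epsE : 0 <= eps%:E by rewrite lee_fin.
  have [kiso _ _] := kP.
  have [_ kfh] := (zdist_leP (dsup_ge0 _ _) (dsup_ge0 _ _) epsE).1
    (kiso f (lip_inf fog)).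
  have /lip_dsup_leP : dsup (k f) (k (lip_inf fog)) <= (a + eps)%:E.
    by rewrite (le_trans kfh)// EFinD leeD2r.
  by case=> //; exact: addr_ge0.
have kg : lip_inf (k \o fog) <=[0%R] k g.
  by apply: le_approx_le => x; apply: ereal_inf_lbound; exists false.
apply: approx_leW (approx_le_trans kfh (approx_le_trans (hom_inf fog).2 kg)).
lra.
Qed.

End homomorphism.

Lemma ml_isomorphism_pairC (R : realType) (A B : extMetric R) (eps : R)
    (k : lip A -> lip B) (k' : lip B -> lip A) :
  ml_isomorphism_pair eps k k' -> ml_isomorphism_pair eps k' k.
Proof. by case. Qed.

(** * Almost isomorphisms: order and constants *)

Section isomorphism.
Context {R : realType} {A B : extMetric R} {eps : R}.
Context {k : lip A -> lip B} {k' : lip B -> lip A}.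
Hypothesis kP : ml_isomorphism_pair eps k k'.

Lemma iso_hom : ml_homomorphism eps k /\ ml_homomorphism eps k'.
Proof. by case: kP. Qed.

Lemma iso_eps_ge0 : (0 <= eps)%R.
Proof. exact: hom_eps_ge0 iso_hom.1. Qed.

Lemma iso_mono (f g : lip A) (a : R) : (0 <= a)%R ->
  f <=[a] g -> k f <=[(a + 2 * eps)%R] k g.
Proof. move=> a0 fg; exact: (hom_mono iso_hom.1). Qed.

Lemma iso_mono' (f g : lip B) (a : R) : (0 <= a)%R ->
  f <=[a] g -> k' f <=[(a + 2 * eps)%R] k' g.
Proof. move=> a0 fg; exact: (hom_mono iso_hom.2). Qed.

Lemma iso_near (g : lip B) : k (k' g) <=[eps] g /\ g <=[eps] k (k' g).
Proof.
have eps0 := iso_eps_ge0.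
by apply/lip_dsup_leP => //; case: kP => _ _ + _; apply.
Qed.

Lemma iso_near' (f : lip A) : k' (k f) <=[eps] f /\ f <=[eps] k' (k f).
Proof.
have eps0 := iso_eps_ge0.
by apply/lip_dsup_leP => //; case: kP => _ _ _; apply.
Qed.

(** The converse bound for [k'] comes first: from [c <= 0 + c], the image of
    [c] under [k'] is at most the image of [0] plus almost [c] (an infinite [c]
    is no restriction).  Applying [k] turns this upper bound into a lower bound
    for [k c]. *)
Lemma iso_cst (c : \bar R) (c0 : 0 <= c) :
  cst_lip c0 <=[(6 * eps)%R] k (cst_lip c0).
Proof.
have eps0 := iso_eps_ge0.
have k'c : k' (cst_lip c0) <=[(3 * eps)%R] cst_lip c0.
  case: c c0 => [c| |] c0 // x; last by rewrite /= leey.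
  have cR : (0 <= c)%R by rewrite -lee_fin.
  have c_le : (cst_lip c0 : lip B) <=[c] cst_lip (lexx 0).
    by move=> y; rewrite /= add0e.
  have := approx_le_trans (iso_mono' cR c_le) (hom_zero iso_hom.2).
  move=> /(_ x)/le_trans; apply; rewrite /= add0e -EFinD lee_fin; lra.
have e3 : (0 <= 3 * eps)%R by lra.
apply: approx_leW (approx_le_trans (iso_near _).2 (iso_mono e3 k'c)).
lra.
Qed.

End isomorphism.

(** * Images of cones and vertices *)

Section cone_images.
Context {R : realType} {A B : extMetric R} {eps : R}.
Context {k : lip A -> lip B} {k' : lip B -> lip A}.
Hypothesis kP : ml_isomorphism_pair eps k k'.

(** Among the cones whose infimum is [k' (cone x c)], one is almost equal to
    that infimum because [cone x c] is prime.  The constants leave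
    [14 * eps] for each side when [delta <= eps]. *)
Lemma iso_cone (x : B) (c : R) (c0 : 0 <= c%:E) (delta : R) :
    (0 < delta)%R ->
  exists y, k' (cone x c0) <=[(10 * eps + delta)%R] cone y c0 /\
            cone y c0 <=[(13 * eps + delta)%R] k' (cone x c0).
Proof.
have eps0 := iso_eps_ge0 kP.
move=> delta0; set q := k' (cone x c0).
pose V y := cone y (lip_ge0 q y).
have [y ky] : exists y, k (V y) x <= c%:E + (2 * eps + delta)%:E.
  have /(_ x) : lip_inf (k \o V) <=[(2 * eps)%R] cone x c0.
    have := (hom_inf (iso_hom kP).1 V).1; rewrite lip_inf_cones => kV.
    apply: approx_leW (approx_le_trans kV (iso_near kP _).1); lra.
  rewrite cone_apex => kVx.
  have : lip_inf (k \o V) x < c%:E + (2 * eps + delta)%:E.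
    by rewrite (le_lt_trans kVx)// -!EFinD lte_fin; lra.
  by move=> /ereal_inf_lt[_ [y _ <-]] /ltW ky; exists y.
exists y; set a := q y; have a0 : 0 <= a := lip_ge0 q y.
have qV : q <=[0%R] V y by apply: approx_le_cone; rewrite adde0.
have kV : k (V y) <=[(2 * eps + delta)%R] cone x c0 by exact: approx_le_cone.
have d0 : (0 <= 2 * eps + delta)%R by lra.
have Vq : V y <=[(5 * eps + delta)%R] q.
  apply: approx_leW (approx_le_trans (iso_near' kP _).2 (iso_mono' kP d0 kV)).
  lra.
(* The apex value [a] of the cone found is compared with [c] through the
   constant functions [c] and [a], which lie below the respective cones. *)
have ca : c%:E <= a + (8 * eps)%:E.
  have cx : cst_lip c0 <=[0%R] cone x c0.
    by apply: le_approx_le => z; rewrite /= leeDl// dist_ge0.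
  have := approx_le_trans (iso_cst (ml_isomorphism_pairC kP) c0)
    (iso_mono' kP (lexx 0%R) cx).
  by move=> /(_ y)/le_trans; apply; rewrite leeD2l// lee_fin; lra.
have ac : a <= c%:E + (10 * eps + delta)%:E.
  have ay : cst_lip a0 <=[0%R] V y.
    by apply: le_approx_le => z; rewrite /= leeDl// dist_ge0.
  have := approx_le_trans (iso_cst kP a0) (approx_le_trans
    (iso_mono kP (lexx 0%R) ay) kV).
  move=> /(_ x)/le_trans; apply; rewrite cone_apex leeD2l// lee_fin; lra.
split.
  apply: approx_leW (approx_le_trans qV (cone_mono y _ c0 ac)); lra.
apply: approx_leW (approx_le_trans (cone_mono y c0 _ ca) Vq); lra.
Qed.

Lemma iso_vertex (cA : em_complete A) (x : B) : exists y,
  k' (vertex x) <=[(14 * eps)%R] vertex y /\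
  vertex y <=[(14 * eps)%R] k' (vertex x).
Proof.
have eps0 := iso_eps_ge0 kP.
have [eps_gt0|eps_le0] := ltP 0%R eps.
  have [y [xy yx]] := iso_cone x (lexx 0) eps_gt0; exists y.
  by split; [apply: approx_leW xy|apply: approx_leW yx]; lra.
(* There is no slack left to absorb [delta], so exactness comes from letting
   [delta] tend to [0]. *)
have eps_eq0 : eps = 0%R by lra.
have [y ->] : exists y, k' (vertex x) = vertex y.
  apply: vertex_closed => // delta delta0.
  have [y [xy yx]] := iso_cone x (lexx 0) delta0; exists y.
  apply/lip_dsup_leP; first exact: ltW.
  by split; [apply: approx_leW xy|apply: approx_leW yx]; lra.
exists y; split; apply: approx_leW (le_approx_le (fun=> lexx _)); lra.
Qed.

(** The images of a cone and of a vertex at [x] are almost a cone at some [z]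
    and the vertex at [y].  From [cone x c <= vertex x + c] one gets almost
    [c + dist z y <= c] at the point [y], so [z] is near [y]. *)
Lemma iso_cone_at_vertex_image (x : B) (y : A) (c : R) (c0 : 0 <= c%:E)
    (delta : R) :
    (0 < delta)%R -> k' (vertex x) <=[(14 * eps)%R] vertex y ->
  k' (cone x c0) <=[(42 * eps + delta)%R] cone y c0 /\
  cone y c0 <=[(42 * eps + delta)%R] k' (cone x c0).
Proof.
have eps0 := iso_eps_ge0 kP.
move=> delta0 xy; have delta20 : (0 < delta / 2)%R by lra.
have [z [xz zx]] := iso_cone x c0 delta20.
have cR : (0 <= c)%R by rewrite -lee_fin.
have zy : dist z y <= (29 * eps + delta / 2)%:E.
  have cx : cone x c0 <=[c] vertex x.
    by apply: cone_mono; rewrite add0e.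
  have := approx_le_trans zx (approx_le_trans (iso_mono' kP cR cx) xy).
  move=> /(_ y); rewrite cone_apex /= add0e.
  rewrite (_ : (_ + _)%R = c + (29 * eps + delta / 2))%R; last by lra.
  by rewrite EFinD leeD2lE.
split.
  have : cone z c0 <=[(29 * eps + delta / 2)%R] cone y c0.
    by apply: approx_le_cone; rewrite /= leeD2l.
  by move/(approx_le_trans xz); apply: approx_leW; lra.
have : cone y c0 <=[(29 * eps + delta / 2)%R] cone z c0.
  by apply: approx_le_cone; rewrite /= leeD2l// dist_sym.
by move/approx_le_trans => /(_ _ _ zx); apply: approx_leW; lra.
Qed.

Lemma vertex_images_dist_le (x x' : B) (y y' : A) :
    vertex y <=[(14 * eps)%R] k' (vertex x) ->
    k' (vertex x') <=[(14 * eps)%R] vertex y' ->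
  dist y y' <= dist x x' + (30 * eps)%:E.
Proof.
have eps0 := iso_eps_ge0 kP.
move=> yx xy'; have [->|xx'] := eqVneq (dist x x') +oo; first by rewrite leey.
have dxx' : dist x x' = (fine (dist x x'))%:E.
  by rewrite fineK// ge0_fin_numE ?dist_ge0// ltey.
have d0 : (0 <= fine (dist x x'))%R by rewrite fine_ge0// dist_ge0.
have /vertex_approx_leP xx'_le : dist x x' <= (fine (dist x x'))%:E.
  by rewrite -dxx'.
rewrite dxx' -EFinD; apply/vertex_approx_leP.
apply: approx_leW (approx_le_trans yx (approx_le_trans
  (iso_mono' kP d0 xx'_le) xy')); lra.
Qed.

Lemma dist_le_vertex_images (x x' : B) (y y' : A) :
    k' (vertex x) <=[(14 * eps)%R] vertex y ->
    vertex y' <=[(14 * eps)%R] k' (vertex x') ->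
  dist x x' <= dist y y' + (32 * eps)%:E.
Proof.
have eps0 := iso_eps_ge0 kP.
move=> xy yx'; have [->|yy'] := eqVneq (dist y y') +oo; first by rewrite leey.
have dyy' : dist y y' = (fine (dist y y'))%:E.
  by rewrite fineK// ge0_fin_numE ?dist_ge0// ltey.
have d0 : (0 <= fine (dist y y') + 28 * eps)%R.
  by rewrite addr_ge0 ?fine_ge0 ?dist_ge0//; lra.
have /vertex_approx_leP yy'_le : dist y y' <= (fine (dist y y'))%:E.
  by rewrite -dyy'.
have xx' : k' (vertex x) <=[(fine (dist y y') + 28 * eps)%R] k' (vertex x').
  apply: approx_leW (approx_le_trans xy (approx_le_trans yy'_le yx')); lra.
rewrite dyy' -EFinD; apply/vertex_approx_leP.
apply: approx_leW (approx_le_trans (iso_near kP _).2 (approx_le_trans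
  (iso_mono kP d0 xx') (iso_near kP _).1)); lra.
Qed.

Lemma vertex_image_round_trip (x : B) (y y' : A) :
    vertex x <=[(14 * eps)%R] k (vertex y) ->
    vertex y' <=[(14 * eps)%R] k' (vertex x) ->
  dist y' y <= (31 * eps)%:E.
Proof.
have eps0 := iso_eps_ge0 kP.
move=> xy yx; have e14 : (0 <= 14 * eps)%R by lra.
apply/vertex_approx_leP.
apply: approx_leW (approx_le_trans yx (approx_le_trans
  (iso_mono' kP e14 xy) (iso_near' kP _).1)); lra.
Qed.

(** A finite value [f y = a] says [f <= cone y a], and [cone y a] is almost
    [k' (cone x a)], so applying [k] bounds [k f x]; the other bound is dual.
    An infinite value makes the bound by it trivial.  The arbitrary [delta]
    disappears because only inequalities between values are left. *)
Lemma eval_vertex_image (x : B) (y : A) (f : lip A) :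
    k' (vertex x) <=[(14 * eps)%R] vertex y ->
  k f x <= f y + (45 * eps)%:E /\ f y <= k f x + (45 * eps)%:E.
Proof.
have eps0 := iso_eps_ge0 kP.
move=> xy; split; apply/lee_addgt0Pr => delta delta0.
  case fy : (f y) => [a| |]; last 2 first.
  - by rewrite addye ?leey.
  - by have := lip_ge0 f y; rewrite fy.
  have a0 : 0 <= a%:E by rewrite -fy lip_ge0.
  have fa : f <=[0%R] cone y a0 by apply: approx_le_cone; rewrite fy adde0.
  have [_ yx] := iso_cone_at_vertex_image a0 delta0 xy.
  have d0 : (0 <= 0 + (42 * eps + delta))%R by lra.
  have := approx_le_trans (iso_mono kP d0 (approx_le_trans fa yx))
    (iso_near kP _).1.
  move=> /(_ x)/le_trans; apply; rewrite cone_apex -!EFinD lee_fin; lra.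
case kfx : (k f x) => [b| |]; last 2 first.
- by rewrite addye ?leey.
- by have := lip_ge0 (k f) x; rewrite kfx.
have b0 : 0 <= b%:E by rewrite -kfx lip_ge0.
have kfb : k f <=[0%R] cone x b0 by apply: approx_le_cone; rewrite kfx adde0.
have [xy' _] := iso_cone_at_vertex_image b0 delta0 xy.
have := approx_le_trans (iso_near' kP f).2 (approx_le_trans
  (iso_mono' kP (lexx 0%R) kfb) xy').
move=> /(_ y)/le_trans; apply; rewrite cone_apex -!EFinD lee_fin; lra.
Qed.

End cone_images.

Local Close Scope ereal_scope.

Theorem theorem2 (R : realType) (X Y : extMetric R)
    (cX : em_complete X) (cY : em_complete Y)
    (eps : R) (eps0 : 0 <= eps)
    (kappa : lip Y -> lip X) (kappa' : lip X -> lip Y)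
    (kappaP : ml_isomorphism_pair eps kappa kappa') :
  exists (eta : X -> Y) (eta' : Y -> X),
    isometry_pair (88 * eps) eta eta' /\
    forall f : lip Y, (dsup (kappa f) (f \o eta) <= (62 * eps)%:E)%E.
Proof.
have kappaP' := ml_isomorphism_pairC kappaP.
have [eta etaP] := choice (iso_vertex kappaP cY).
have [eta' eta'P] := choice (iso_vertex kappaP' cX).
have eps88 : (0 <= (88 * eps)%:E)%E by rewrite lee_fin; lra.
exists eta, eta'; split; [split|].
- move=> x x'; apply/zdist_leP; rewrite ?dist_ge0//; split.
    apply: le_trans (dist_le_vertex_images kappaP (etaP x).1 (etaP x').2) _.
    by rewrite leeD2l// lee_fin; lra.
  apply: le_trans (vertex_images_dist_le kappaP (etaP x).2 (etaP x').1) _.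
  by rewrite leeD2l// lee_fin; lra.
- move=> y y'; apply/zdist_leP; rewrite ?dist_ge0//; split.
    apply: le_trans (dist_le_vertex_images kappaP' (eta'P y).1 (eta'P y').2) _.
    by rewrite leeD2l// lee_fin; lra.
  apply: le_trans (vertex_images_dist_le kappaP' (eta'P y).2 (eta'P y').1) _.
  by rewrite leeD2l// lee_fin; lra.
- move=> y.
  apply: le_trans (vertex_image_round_trip kappaP (eta'P y).2 (etaP _).2) _.
  by rewrite lee_fin; lra.
- move=> x.
  apply: le_trans (vertex_image_round_trip kappaP' (etaP x).2 (eta'P _).2) _.
  by rewrite lee_fin; lra.
move=> f; apply: (@le_trans _ _ (45 * eps)%:E); last by rewrite lee_fin; lra.
apply/dsup_leP => [x|x||]; rewrite ?lip_ge0//; first by lra.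
by split=> x; have [] := eval_vertex_image kappaP f (etaP x).1.
Qed.
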